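(* Let $P=\left\{\begin{pmatrix}0&1\\1&0\end{pmatrix},\begin{pmatrix}1&1\\1&0\end{pmatrix}\right\}$, and let $n,k\ge 1$ be integers. (i) The number of $n\times k$ $01$ matrices that contain no element of $P$ as a submatrix equals $B_{n,k}$. (ii) The number of $n\times k$ $01$ matrices that contain no element of $P$ as a submatrix and in which every column contains at least one $1$ equals $C_{n,k}$. (iii) The number of $n\times k$ $01$ matrices that contain no element of $P$ as a submatrix and in which every row and every column contains at least one $1$ equals $D_{n,k}$.
   Context: A submatrix of a matrix is one obtained by deleting rows and columns (keeping the order of those remaining). A $01$ matrix is lonesum if it is uniquely determined among $01$ matrices of its size by its row sum vector and column sum vector; equivalently (Ryser), it contains neither $\begin{pmatrix}1&0\\0&1\end{pmatrix}$ nor $\begin{pmatrix}0&1\\1&0\end{pmatrix}$ as a submatrix. $B_{n,k}$ is the poly-Bernoulli number $B_n^{(-k)}$, defined by $\sum_{n\ge0}B_n^{(-k)}\frac{x^n}{n!}=\frac{Li_{-k}(1-e^{-x})}{1-e^{-x}}$ with $Li_{-k}(z)=\sum_{i\ge1}i^k z^i$; equivalently (Brewbaker), $B_{n,k}$ is the number of lonesum $01$ matrices of size $n\times k$. $C_{n,k}$ is the number of lonesum $01$ matrices of size $n\times k$ in which every column contains at least one $1$. $D_{n,k}$ is the number of lonesum $01$ matrices of size $n\times k$ in which every column and every row contains at least one $1$. *)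

(* Defs.v *)
From mathcomp Require Import all_boot all_order all_algebra.

Set Implicit Arguments.
Unset Strict Implicit.
Unset Printing Implicit Defensive.

Import Order.TTheory GRing.Theory Num.Theory.

Local Open Scope nat_scope.

(* 01 matrices are matrices over bool, with true for 1 and false for 0. *)

Definition mx2 (a b c d : bool) : 'M[bool]_2 :=
  \matrix_(i < 2, j < 2)
    if i == 0 :> nat then (if j == 0 :> nat then a else b)
    else (if j == 0 :> nat then c else d).

Definition increasing (p n : nat) (f : 'I_p -> 'I_n) : bool :=
  [forall i : 'I_p, forall j : 'I_p, (i < j) ==> (f i < f j)].

(* The rows and columns that are kept are the images of f and g. *)
Definition is_submatrix (p q n k : nat)
    (Q : 'M[bool]_(p, q)) (A : 'M[bool]_(n, k)) : bool :=
  [exists f : {ffun 'I_p -> 'I_n}, exists g : {ffun 'I_q -> 'I_k},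
    [&& increasing f, increasing g & mxsub f g A == Q]].

Definition avoids (p q n k : nat)
    (P : {set 'M[bool]_(p, q)}) (A : 'M[bool]_(n, k)) : bool :=
  [forall Q in P, ~~ is_submatrix Q A].

Definition row_sums (n k : nat) (A : 'M[bool]_(n, k)) : 'cV[nat]_n :=
  \col_i \sum_(j < k) A i j.

Definition col_sums (n k : nat) (A : 'M[bool]_(n, k)) : 'rV[nat]_k :=
  \row_j \sum_(i < n) A i j.

Definition lonesum (n k : nat) (A : 'M[bool]_(n, k)) : bool :=
  [forall A' : 'M[bool]_(n, k),
    (row_sums A' == row_sums A) && (col_sums A' == col_sums A) ==> (A' == A)].

Definition every_col_has_1 (n k : nat) (A : 'M[bool]_(n, k)) : bool :=
  [forall j, exists i, A i j].

Definition every_row_has_1 (n k : nat) (A : 'M[bool]_(n, k)) : bool :=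
  [forall i, exists j, A i j].

Definition lonesum_C (n k : nat) : nat :=
  #|[set A : 'M[bool]_(n, k) | lonesum A & every_col_has_1 A]|.

Definition lonesum_D (n k : nat) : nat :=
  #|[set A : 'M[bool]_(n, k) |
      [&& lonesum A, every_col_has_1 A & every_row_has_1 A]]|.

Local Open Scope ring_scope.

(* A formal power series over rat is its sequence of coefficients. *)
Definition fps := nat -> rat.

Definition fps_mul (f g : fps) : fps :=
  fun n => \sum_(i < n.+1) f i * g (n - i)%N.

Definition fps_exp (f : fps) (m : nat) : fps :=
  iter m (fps_mul f) (fun n => (n == 0%N)%:R).

(* The composite f(g(x)), for g with zero constant term: g ^ i then has order
   at least i, so only the terms with i <= n contribute to the coefficient of
   x ^ n. *)
Definition fps_comp (f g : fps) : fps :=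
  fun n => \sum_(i < n.+1) f i * fps_exp g i n.

(* The quotient of f by its variable, for f with zero constant term. *)
Definition fps_divX (f : fps) : fps := fun n => f n.+1.

(* Li_{-k}(z), the sum of i ^ k z ^ i over i >= 1. *)
Definition polylog_neg (k : nat) : fps :=
  fun i => if i == 0%N then 0 else (i ^ k)%N%:R.

(* 1 - e^{-x} *)
Definition one_sub_expN : fps :=
  fun n => (n == 0%N)%:R - (-1) ^+ n / (n`!)%:R.

(* Li_{-k}(z) / z at z = 1 - e^{-x}. The lemma poly_bernoulli_gfP below shows
   that this is the unique power series quotient of Li_{-k}(1 - e^{-x}) by
   1 - e^{-x}. *)
Definition poly_bernoulli_gf (k : nat) : fps :=
  fps_comp (fps_divX (polylog_neg k)) one_sub_expN.

(* The poly-Bernoulli number B_n^{(-k)}, which is n! times the coefficient of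
   x ^ n in its exponential generating function. *)
Definition poly_bernoulli (n k : nat) : rat :=
  (n`!)%:R * poly_bernoulli_gf k n.

Lemma one_sub_expN0 : one_sub_expN 0 = 0.
Proof. by rewrite /one_sub_expN expr0 fact0 divr1 subrr. Qed.

Lemma one_sub_expN1 : one_sub_expN 1 = 1.
Proof. by rewrite /one_sub_expN expr1 divr1 sub0r opprK. Qed.

Lemma fps_exp_small (g : fps) (m n : nat) :
  g 0%N = 0 -> (n < m)%N -> fps_exp g m n = 0.
Proof.
move=> g0; elim: m n => // m IHm n le_nm.
rewrite /fps_exp iterS -/(fps_exp g m) /fps_mul big_ord_recl g0 mul0r add0r.
apply: big1 => i _; rewrite IHm ?mulr0 //= /bump /= add1n.
by case: n i le_nm => [[]|n] // i le_nm; rewrite subSS (leq_ltn_trans (leq_subr _ _)).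
Qed.

Lemma fps_mulC (f g : fps) : fps_mul f g =1 fps_mul g f.
Proof.
move=> n; rewrite /fps_mul (reindex_inj rev_ord_inj) /=.
apply: eq_bigr => i _; rewrite mulrC subSS subKn //; exact: leq_ord.
Qed.

Lemma poly_bernoulli_gfP (k : nat) (f : fps) :
  fps_mul f one_sub_expN =1 fps_comp (polylog_neg k) one_sub_expN <->
  f =1 poly_bernoulli_gf k.
Proof.
have gfE : fps_mul (poly_bernoulli_gf k) one_sub_expN
    =1 fps_comp (polylog_neg k) one_sub_expN.
  move=> n; rewrite fps_mulC /fps_comp big_ord_recl mul0r add0r.
  rewrite /fps_mul /poly_bernoulli_gf /fps_comp.
  transitivity (\sum_(i < n.+1) \sum_(j < n.+1)
     one_sub_expN i * (fps_divX (polylog_neg k) j * fps_exp one_sub_expN j (n - i)%N)).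
    apply: eq_bigr => i _; rewrite mulr_sumr.
    rewrite (big_ord_widen n.+1 (fun j => one_sub_expN i *
      (fps_divX (polylog_neg k) j * fps_exp one_sub_expN j (n - i)%N))) ?ltnS ?leq_subr //.
    rewrite [RHS](bigID (fun j : 'I_n.+1 => (j < (n - i).+1)%N)) /=.
    rewrite [X in _ = _ + X]big1 ?addr0 // => j.
    rewrite -leqNgt => lt_j; by rewrite (fps_exp_small one_sub_expN0) ?mulr0.
  rewrite exchange_big big_ord_recr /= [X in _ + X]big1 ?addr0; last first.
    move=> i _; case: (posnP i) => [-> | i_gt0]; first by rewrite one_sub_expN0 mul0r.
    rewrite (fps_exp_small one_sub_expN0) ?mulr0 //.
    by rewrite -subn_gt0 subKn // leq_ord.
  apply: eq_bigr => j _.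
  transitivity (polylog_neg k j.+1 *
    \sum_(i < n.+1) one_sub_expN i * fps_exp one_sub_expN j (n - i)%N) => //.
  by rewrite mulr_sumr; apply: eq_bigr => i _; exact: mulrCA.
split=> [fE n | fE n]; last first.
  by rewrite -gfE; apply: eq_bigr => i _; rewrite fE.
elim/ltn_ind: n => n IHn.
have := fE n.+1; rewrite -gfE /fps_mul !(big_ord_recr n.+1) /= subnn one_sub_expN0.
rewrite !mulr0 !addr0 !(big_ord_recr n) /= subSnn one_sub_expN1 !mulr1.
under eq_bigr => i _ do rewrite IHn //.
exact: addrI.
Qed.

(* Main.v *)
Require Import Defs.
From mathcomp Require Import all_boot all_order all_algebra.
From mathcomp Require Import perm ring zify.

Import GRing.Theory.

Set Implicit Arguments.
Unset Strict Implicit.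
Unset Printing Implicit Defensive.

(** Both families of matrices are built one column at a time, and in both the
    number of choices obeys the same recursion.  Write N(r, k) for the number of
    members with k columns whose nonzero rows lie in a given set of r rows.

    - Matrices avoiding P have the property of Le-diagrams: a cell with a 1 above
      it in its column and a 1 to its left in its row holds a 1.  If the last
      column S is nonempty with topmost row m, the rows below m outside S must
      vanish, and deleting them leaves an arbitrary member.  The set formed by m
      and these rows is an arbitrary nonempty set T of rows.
    - Lonesum matrices are those whose rows form a chain for inclusion (Ryser).
      If the last column S is nonempty, the rows of S that are smallest in the
      rest of the matrix form a nonempty set T of equal rows, and S is recovered
      from T by adding the rows larger than those of T.  Merging the equal rows
      of T into one leaves an arbitrary member.

    In both cases a nonempty T leaves r - |T| + 1 rows, so that
      N(r, k + 1) = N(r, k) + sum over t >= 1 of 'C(r, t) N(r - t + 1, k),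
    and the first term disappears when zero columns are forbidden
    ([colwise_count], [count_le_property], [count_nested]).  This gives (ii).
    The count for every set R of allowed rows determines the count for every
    exact set of nonzero rows by inversion over subsets ([eq_count_on]), which
    gives (iii).

    For (i), n! times the coefficient of x ^ n in (1 - e^{-x}) ^ i is the value
    at 0 of the i-th backward difference of y ^ n, because multiplying by e^{-x}
    shifts y by -1.  Hence the poly-Bernoulli number is
      sum over i <= n of (i + 1) ^ k (nabla ^ i y ^ n)(0),
    and the Leibniz rule for nabla ^ i (y f(y)) turns the factor i + 1 into the
    recursion above ([mul_nabla_pow0], [poly_bernoulliS]). *)

(** * Adding a last column *)

(** The common value of the two counts for k columns and r available rows; the
    flag z tells whether zero columns are allowed. *)
Fixpoint colwise_count (z : bool) (k r : nat) : nat :=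
  if k is k'.+1 then
    z * colwise_count z k' r
      + \sum_(m < r) 'C(r, m.+1) * colwise_count z k' (r - m)
  else 1.

Lemma sum_nonempty_subsets (T : finType) (R : {set T}) (f : nat -> nat) :
  \sum_(S : {set T} | (S \subset R) && (S != set0)) f #|S|.-1
    = \sum_(m < #|R|) 'C(#|R|, m.+1) * f m.
Proof.
rewrite (partition_big (fun S : {set T} => inord #|S| : 'I_#|R|.+1) predT) //=.
rewrite big_ord_recl big1 ?add0n => [|S]; last first.
  case/andP=> /andP[/subset_leq_card le_SR S_neq0] /eqP/(congr1 val).
  by rewrite /= inordK // => /eqP; rewrite cards_eq0 (negPf S_neq0).
apply: eq_bigr => m _; rewrite -cards_draws -sum_nat_const.
rewrite [RHS](eq_bigl (fun S : {set T} => (S \subset R) && (#|S| == m.+1)));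
  last by move=> S; rewrite inE.
apply: eq_big => [S|S /andP[/andP[sSR _] /eqP eq_m]].
  case: (boolP (S \subset R)) => //= sSR.
  rewrite -[_ == lift _ _]val_eqE /= inordK ?ltnS ?subset_leq_card //.
  by rewrite -cards_eq0; case: eqP => [->|_].
congr f; move/(congr1 val): eq_m.
by rewrite /= inordK ?ltnS ?subset_leq_card // => ->.
Qed.

Lemma card_in_cancel (T U : finType) (A : {set T}) (B : {set U})
    (f : T -> U) (g : U -> T) :
    {in A, forall x, f x \in B /\ g (f x) = x} ->
    {in B, forall y, g y \in A /\ f (g y) = y} ->
  #|A| = #|B|.
Proof.
move=> fP gP; have <- : f @: A = B.
  apply/setP=> y; apply/imsetP/idP => [[x Ax ->]|By]; first by case: (fP x Ax).
  by exists (g y); case: (gP y By).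
rewrite card_in_imset // => x x' Ax Ax' eq_f.
by have [_ <-] := fP x Ax; have [_ <-] := fP x' Ax'; rewrite eq_f.
Qed.

Definition add_col (n k : nat) (M : 'M[bool]_(n, k)) (S : {set 'I_n}) :
    'M[bool]_(n, k.+1) :=
  (\matrix_(i, j) if unlift ord_max j is Some j' then M i j' else i \in S)%R.

Lemma add_col_lift (n k : nat) (M : 'M[bool]_(n, k)) (S : {set 'I_n}) i j :
  add_col M S i (lift ord_max j) = M i j.
Proof. by rewrite mxE liftK. Qed.

Lemma add_col_max (n k : nat) (M : 'M[bool]_(n, k)) (S : {set 'I_n}) i :
  add_col M S i ord_max = (i \in S).
Proof. by rewrite mxE unlift_none. Qed.

Lemma card_add_col (n k : nat) (Q : pred 'M[bool]_(n, k.+1)) :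
  #|[set A | Q A]| = \sum_(S : {set 'I_n}) #|[set M | Q (add_col M S)]|.
Proof.
pose last_col (A : 'M[bool]_(n, k.+1)) := [set i | A i ord_max].
rewrite -sum1_card (partition_big last_col predT) //=; apply: eq_bigr => S _.
pose init (A : 'M[bool]_(n, k.+1)) := (\matrix_(i, j) A i (lift ord_max j))%R.
rewrite sum1_card -cardsE; apply: (@card_in_cancel _ _ _ _ init (fun M => add_col M S)).
- move=> A; rewrite !inE => /andP[QA /eqP <-].
  have eqA : add_col (init A) (last_col A) = A.
    apply/matrixP=> i j; case: (unliftP ord_max j) => [j'|] ->.
      by rewrite add_col_lift mxE.
    by rewrite add_col_max inE.
  by rewrite eqA; move: QA; rewrite inE.
- move=> M; rewrite !inE => QM; split; last first.
    by apply/matrixP=> i j; rewrite mxE add_col_lift.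
  by rewrite unfold_in inE QM /=; apply/eqP/setP => i; rewrite inE add_col_max.
Qed.

Definition rows_in (n k : nat) (R : {set 'I_n}) (A : 'M[bool]_(n, k)) : bool :=
  [forall i, forall j, A i j ==> (i \in R)].

Lemma rows_inP (n k : nat) (R : {set 'I_n}) (A : 'M[bool]_(n, k)) :
  reflect (forall i j, A i j -> i \in R) (rows_in R A).
Proof.
by apply: (iffP forallP) => h i; [move=> j; move/forallP: (h i) => /(_ j)/implyP
  | apply/forallP=> j; apply/implyP/h].
Qed.

Lemma rows_in_add_col (n k : nat) (R S : {set 'I_n}) (M : 'M[bool]_(n, k)) :
  rows_in R (add_col M S) = (S \subset R) && rows_in R M.
Proof.
apply/rows_inP/andP => [h | [/subsetP sSR /rows_inP h] i j].
  split; first by apply/subsetP=> i iS; apply: (h i ord_max); rewrite add_col_max.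
  by apply/rows_inP=> i j Mij; apply: (h i (lift ord_max j)); rewrite add_col_lift.
by case: (unliftP ord_max j) => [j'|] ->; rewrite ?add_col_lift ?add_col_max;
  [exact: h | exact: sSR].
Qed.

Lemma every_colP (n k : nat) (A : 'M[bool]_(n, k)) :
  reflect (forall j, exists i, A i j) (every_col_has_1 A).
Proof. by apply: (iffP forallP) => h j; exact/existsP. Qed.

Lemma every_col_add_col (n k : nat) (S : {set 'I_n}) (M : 'M[bool]_(n, k)) :
  every_col_has_1 (add_col M S) = (S != set0) && every_col_has_1 M.
Proof.
apply/every_colP/andP => [h | [/set0Pn[i iS] /every_colP h] j].
  split; first by have [i] := h ord_max; rewrite add_col_max => iS; apply/set0Pn; exists i.
  by apply/every_colP=> j; have [i] := h (lift ord_max j); rewrite add_col_lift; exists i.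
case: (unliftP ord_max j) => [j'|] ->.
  by have [i' Mij] := h j'; exists i'; rewrite add_col_lift.
by exists i; rewrite add_col_max.
Qed.

(** Keeping the number of rows fixed and restricting the set R of rows that may
    be nonzero replaces the deletion of rows, so that no change of index type is
    needed in the recursion. *)
Definition count_in (n : nat) (X : forall k, pred 'M[bool]_(n, k))
    (z : bool) (k : nat) (R : {set 'I_n}) : nat :=
  #|[set A : 'M[bool]_(n, k) | [&& X k A, z || every_col_has_1 A & rows_in R A]]|.

Lemma count_in0 (n : nat) (X : forall k, pred 'M[bool]_(n, k)) (z : bool) (R : {set 'I_n}) :
  (forall A, X 0 A) -> count_in X z 0 R = 1.
Proof.
move=> X0; rewrite -(cards1 (const_mx false : 'M[bool]_(n, 0))) /count_in.
congr #|pred_of_set _|; apply/setP=> A; rewrite !inE X0 /=.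
have -> : A == const_mx false by apply/eqP/matrixP=> ? [].
apply/andP; split; last by apply/rows_inP=> ? [].
by apply/orP; right; apply/every_colP; case.
Qed.

Lemma count_inS (n : nat) (X : forall k, pred 'M[bool]_(n, k)) (z : bool)
    (k : nat) (R : {set 'I_n}) :
    (forall M : 'M_(n, k), X k.+1 (add_col M set0) = X k M) ->
  count_in X z k.+1 R = z * count_in X z k R
    + \sum_(S : {set 'I_n} | (S \subset R) && (S != set0))
        #|[set M : 'M[bool]_(n, k) |
            [&& X k.+1 (add_col M S), z || every_col_has_1 M & rows_in R M]]|.
Proof.
move=> X0; rewrite /count_in card_add_col (bigD1 set0) //=; congr (_ + _).
  case: z => /=; last first.
    rewrite mul0n; apply/eqP; rewrite cards_eq0; apply/eqP/setP=> M.
    by rewrite !inE every_col_add_col eqxx /= andbF.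
  by rewrite mul1n; apply: eq_card => M; rewrite !inE X0 rows_in_add_col sub0set.
rewrite (bigID (fun S : {set 'I_n} => S \subset R)) /= [X in _ + X]big1 ?addn0.
  apply: eq_big => [S|S /andP[S0 sSR]]; first by rewrite andbC.
  by apply: eq_card => M; rewrite !inE rows_in_add_col every_col_add_col S0 sSR.
move=> S /andP[_ /negPf nSR]; apply/eqP; rewrite cards_eq0; apply/eqP/setP=> M.
by rewrite !inE rows_in_add_col nSR !andbF.
Qed.

(** * Matrices with the Le-property *)

(** The condition on fillings in the definition of Le-diagrams and permutation
    tableaux, for a rectangular shape. *)
Definition le_property (n k : nat) (A : 'M[bool]_(n, k)) : bool :=
  [forall i : 'I_n, forall i' : 'I_n, forall j : 'I_k, forall j' : 'I_k,
    [&& i < i', j < j', A i j' & A i' j] ==> A i' j'].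

Lemma le_propertyP (n k : nat) (A : 'M[bool]_(n, k)) :
  reflect (forall (i i' : 'I_n) (j j' : 'I_k),
             i < i' -> j < j' -> A i j' -> A i' j -> A i' j')
          (le_property A).
Proof.
apply: (iffP idP) => [h i i' j j' lt_i lt_j A1 A2 | h].
  by move: h => /forallP/(_ i)/forallP/(_ i')/forallP/(_ j)/forallP/(_ j')/implyP;
    apply; apply/and4P.
apply/forallP=> i; apply/forallP=> i'; apply/forallP=> j; apply/forallP=> j'.
by apply/implyP=> /and4P[? ? ?]; apply: (h i).
Qed.

Definition skipped_below (n : nat) (R S : {set 'I_n}) : {set 'I_n} :=
  [set i in R | (i \notin S) && [exists s in S, s < i]].

(** A row skipped by the last column below a 1 of that column cannot contain a 1,
    which would have the new 0 to its right.  No other constraint arises, since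
    the new column has no column after it. *)
Lemma le_property_add_col (n k : nat) (R S : {set 'I_n}) (M : 'M[bool]_(n, k)) :
  le_property (add_col M S) && rows_in R M
    = le_property M && rows_in (R :\: skipped_below R S) M.
Proof.
apply/andP/andP => [[/le_propertyP leMS /rows_inP inR] |
                    [/le_propertyP leM /rows_inP inR]].
  split.
    apply/le_propertyP=> i i' j j' lt_i lt_j M1 M2.
    have := leMS i i' (lift ord_max j) (lift ord_max j') lt_i.
    by rewrite !add_col_lift !lift_max; apply.
  apply/rows_inP=> i j Mij; rewrite !inE (inR _ _ Mij) andbT /=.
  apply/andP=> -[/negP iNS /existsP[s /andP[sS lt_si]]]; apply: iNS.
  have := leMS s i (lift ord_max j) ord_max lt_si.
  by rewrite add_col_lift !add_col_max lift_max; apply.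
split; last by apply/rows_inP=> i j /inR; rewrite inE => /andP[].
apply/le_propertyP=> i i' j j' lt_i.
case: (unliftP ord_max j) => [l|] ->; last first.
  by case: (unliftP ord_max j') => [l'|] ->; rewrite ?lift_max ?ltnn // ltnNge ltnW.
rewrite add_col_lift lift_max; case: (unliftP ord_max j') => [l'|] ->.
  by rewrite !add_col_lift lift_max; exact: leM.
rewrite !add_col_max => _ iS /inR; rewrite !inE => /andP[+ i'R].
rewrite i'R /= negb_and negbK => /orP[//|/existsP[]].
by exists i; rewrite iS.
Qed.

(** The set made of the topmost element of S and of the rows skipped below it.
    Complementing S below its topmost element is an involution, which is why this
    form is preferred to the union. *)
Definition flip_below (n : nat) (R S : {set 'I_n}) : {set 'I_n} :=
  [set i in R | (i \in S) != [exists s in S, s < i]].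

Lemma exists_min (T : finType) (r : T -> nat) (S : {set T}) :
  S != set0 -> exists2 m, m \in S & {in S, forall i, r m <= r i}.
Proof.
by case/set0Pn=> i0 i0S; case: (arg_minnP r i0S) => m mS min_m; exists m.
Qed.

Lemma exists_below (n : nat) (S : {set 'I_n}) (m i : 'I_n) :
    m \in S -> {in S, forall s : 'I_n, m <= s} ->
  [exists s in S, s < i] = (m < i).
Proof.
move=> mS min_m; apply/existsP/idP => [[s /andP[/min_m le_ms]]|lt_mi].
  exact: leq_ltn_trans.
by exists m; rewrite mS.
Qed.
Lemma flip_belowE (n : nat) (R S : {set 'I_n}) (m : 'I_n) :
    S \subset R -> m \in S -> {in S, forall i : 'I_n, m <= i} ->
  flip_below R S = m |: skipped_below R S /\ m \notin skipped_below R S.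
Proof.
move=> sSR mS min_m.
split; last by rewrite inE mS andbF.
apply/setP=> i; rewrite !inE !(exists_below _ mS min_m).
have [->|neq_im] := eqVneq i m; first by rewrite mS (subsetP sSR) // ltnn.
have [iS|iNS] := boolP (i \in S); last by case: (m < i); rewrite /= ?andbF.
have -> : m < i.
  by rewrite ltn_neqAle min_m // andbT eq_sym; apply: contraNneq neq_im => /val_inj ->.
by rewrite /= !andbF.
Qed.

Lemma flip_below_sub (n : nat) (R S : {set 'I_n}) : flip_below R S \subset R.
Proof. by apply/subsetP=> i; rewrite inE => /andP[]. Qed.

Lemma flip_below_neq0 (n : nat) (R S : {set 'I_n}) :
  S \subset R -> S != set0 -> flip_below R S != set0.
Proof.
move=> sSR /(exists_min (@nat_of_ord n))[m mS min_m]; have [-> _] := flip_belowE sSR mS min_m.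
by apply/set0Pn; exists m; rewrite setU11.
Qed.

Lemma flip_belowK (n : nat) (R S : {set 'I_n}) :
  S \subset R -> S != set0 -> flip_below R (flip_below R S) = S.
Proof.
move=> sSR /(exists_min (@nat_of_ord n))[m mS min_m]; have [flipE _] := flip_belowE sSR mS min_m.
have flip_min : {in flip_below R S, forall i : 'I_n, m <= i}.
  move=> i.
  rewrite flipE !inE => /orP[/eqP -> //|/and3P[_ _ /existsP[s /andP[/min_m le_ms]]]].
  by move/ltnW; exact: leq_trans.
have mF : m \in flip_below R S by rewrite flipE setU11.
apply/setP=> i; rewrite [LHS]inE (exists_below _ mF flip_min).
rewrite inE (exists_below _ mS min_m).
case: (boolP (i \in S)) => [/(subsetP sSR) -> |_].
  by case: (m < i).
by case: (i \in R); case: (m < i).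
Qed.

Lemma count_le_property (n : nat) (z : bool) (k : nat) (R : {set 'I_n}) :
  count_in (@le_property n) z k R = colwise_count z k #|R|.
Proof.
elim: k R => [|k IHk] R; first by apply: count_in0 => A; apply/le_propertyP=> ? ? [].
rewrite count_inS /= => [|M]; last first.
  have := le_property_add_col setT set0 M.
  have inT M' : @rows_in n k setT M' by apply/rows_inP=> i j _; rewrite inE.
  have -> : skipped_below setT set0 = set0 :> {set 'I_n}.
    by apply/setP=> i; rewrite !inE; apply/existsP=> -[s]; rewrite inE.
  by rewrite setD0 !inT !andbT.
rewrite IHk -(sum_nonempty_subsets _ (fun m => colwise_count z k (#|R| - m))).
congr (_ + _).
(* The involution S -> flip_below R S makes |T| - 1 the number of rows lost. *)
rewrite [RHS](reindex_onto (flip_below R) (flip_below R)) /=; last first.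
  by move=> S /andP[]; exact: flip_belowK.
rewrite [RHS](eq_bigl (fun S : {set 'I_n} => (S \subset R) && (S != set0))); last first.
  move=> S; rewrite flip_below_sub /=; apply/andP/andP => [[S0 /eqP <-]|[sSR S0]].
    by rewrite flip_below_sub flip_below_neq0 ?flip_below_sub.
  by rewrite flip_below_neq0 // flip_belowK.
apply: eq_bigr => S /andP[sSR S0].
have [m mS min_m] := exists_min (@nat_of_ord n) S0; have [-> mNskip] := flip_belowE sSR mS min_m.
rewrite cardsU1 mNskip /=.
have <- : #|R :\: skipped_below R S| = #|R| - #|skipped_below R S|.
  by rewrite cardsD (setIidPr _) //; apply/subsetP=> i; rewrite inE => /andP[].
rewrite -IHk; apply: eq_card => M; rewrite !inE andbCA.
by rewrite le_property_add_col andbCA.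
Qed.

(** * Matrices whose rows form a chain *)
Definition row_set (n k : nat) (A : 'M[bool]_(n, k)) (i : 'I_n) : {set 'I_k} :=
  [set j | A i j].

Definition nested (n k : nat) (A : 'M[bool]_(n, k)) : bool :=
  [forall i, forall i', (row_set A i \subset row_set A i')
                          || (row_set A i' \subset row_set A i)].

(** Incomparable rows are exactly what produces one of the two forbidden 2 x 2
    permutation matrices. *)
Lemma nestedP (n k : nat) (A : 'M[bool]_(n, k)) :
  reflect (forall i i' j j', A i j -> A i' j' -> A i j' || A i' j) (nested A).
Proof.
apply: (iffP idP) => [nestA i i' j j' Aij Aij' | h].
  have /forallP/(_ i)/forallP/(_ i')/orP[/subsetP sub|/subsetP sub] := nestA.
    by have:= sub j; rewrite !inE => ->; rewrite ?orbT.
  by have:= sub j'; rewrite !inE => ->.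
apply/forallP=> i; apply/forallP=> i'; apply/norP => -[].
case/subsetPn=> j; rewrite !inE => Aij nAij /subsetPn[j']; rewrite !inE => Aij' nAij'.
by have := h i i' j j' Aij Aij'; rewrite (negPf nAij) (negPf nAij').
Qed.

(** In a chain the cardinal decides inclusion, so the preorder of the rows is
    represented below by a numerical rank. *)
Lemma nested_row_subset (n k : nat) (A : 'M[bool]_(n, k)) (i i' : 'I_n) :
  nested A -> #|row_set A i| <= #|row_set A i'| -> row_set A i \subset row_set A i'.
Proof.
move=> /forallP/(_ i)/forallP/(_ i')/orP[//|sub] le_r.
by have /eqP -> : row_set A i' == row_set A i by rewrite eqEcard sub.
Qed.

Definition dominates (T : finType) (r : T -> nat) (S : {set T}) : bool :=
  [forall i in S, forall i' in ~: S, r i' <= r i].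

Lemma dominatesP (T : finType) (r : T -> nat) (S : {set T}) :
  reflect (forall i i', i \in S -> i' \notin S -> r i' <= r i) (dominates r S).
Proof.
apply: (iffP forall_inP) => [h i i' iS i'S | h i iS].
  by have /forall_inP := h i iS; apply; rewrite inE.
by apply/forall_inP=> i'; rewrite inE; exact: h.
Qed.

Definition constant_on (T : finType) (r : T -> nat) (S : {set T}) : bool :=
  [forall i in S, forall i' in S, r i == r i'].

Lemma constant_onP (T : finType) (r : T -> nat) (S : {set T}) :
  reflect {in S &, forall i i', r i = r i'} (constant_on r S).
Proof.
apply: (iffP forall_inP) => [h i i' iS i'S | h i iS].
  by have /forall_inP/(_ i' i'S)/eqP := h i iS.
by apply/forall_inP=> i' i'S; apply/eqP/h.
Qed.

(** The last column must cut the rows of M along its order, except that ties may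
    be broken arbitrarily. *)
Lemma nested_add_col (n k : nat) (M : 'M[bool]_(n, k)) (S : {set 'I_n}) :
  nested (add_col M S) = nested M && dominates (fun i => #|row_set M i|) S.
Proof.
apply/nestedP/andP => [nestMS | [nestM /dominatesP domS] i i' j j'].
  split.
    apply/nestedP=> i i' j j' Mij Mij'.
    have := nestMS i i' (lift ord_max j) (lift ord_max j').
    by rewrite !add_col_lift; apply.
  apply/dominatesP=> i i' iS i'NS; apply/subset_leq_card/subsetP=> j.
  rewrite !inE => Mij; have := nestMS i i' ord_max (lift ord_max j).
  by rewrite !add_col_lift !add_col_max (negPf i'NS) orbF; apply.
have row_le (x x' : 'I_n) l : x \in S -> M x' l -> M x l || (x' \in S).
  move=> xS Mx'l; case: (boolP (x' \in S)) => [|x'NS]; first by rewrite orbT.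
  have /subsetP/(_ l) := nested_row_subset nestM (domS _ _ xS x'NS).
  by rewrite !inE => ->.
case: (unliftP ord_max j) => [l|] ->; case: (unliftP ord_max j') => [l'|] ->;
  rewrite ?add_col_lift ?add_col_max.
- by move/nestedP: nestM; apply.
- by move=> Mil i'S; rewrite orbC row_le.
- exact: row_le.
- by move=> ->.
Qed.

(** A nonempty set S that dominates its complement is determined by its elements
    of lowest rank: S consists of them and of everything of higher rank.  They
    form an arbitrary nonempty set of constant rank.  Elements outside R have
    rank 0, so that domination need not be restricted to R. *)
Lemma card_dominates (T : finType) (R : {set T}) (r : T -> nat) :
    (forall i, i \notin R -> r i = 0) ->
  #|[set S : {set T} | [&& S \subset R, S != set0 & dominates r S]]|
    = #|[set S : {set T} | [&& S \subset R, S != set0 & constant_on r S]]|.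
Proof.
move=> r0; pose lowest (S : {set T}) := [set i in S | [forall s in S, r i <= r s]].
pose closure (S : {set T}) := [set i in R | (i \in S) || [exists s in S, r s < r i]].
apply: (@card_in_cancel _ _ _ _ lowest closure).
  move=> S; rewrite inE => /and3P[/subsetP sSR S0 /dominatesP domS].
  have [m mS min_m] := exists_min r S0.
  have lowS i : (i \in lowest S) = (i \in S) && (r i <= r m).
    rewrite inE; case: (boolP (i \in S)) => //= iS.
    apply/forall_inP/idP => [/(_ m mS) //|le_im s /min_m]; exact: leq_trans.
  split.
    rewrite inE; apply/and3P; split.
    - by apply/subsetP=> i; rewrite lowS => /andP[/sSR].
    - by apply/set0Pn; exists m; rewrite lowS mS leqnn.
    - apply/constant_onP=> i i'; rewrite !lowS => /andP[iS le_i] /andP[i'S le_i'].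
      by apply/eqP; rewrite eqn_leq (leq_trans le_i) ?min_m // (leq_trans le_i') ?min_m.
  apply/setP=> i; rewrite inE; case: (boolP (i \in S)) => [iS|iNS].
    rewrite sSR //= lowS iS /=; case: leqP => //= lt_mi.
    by apply/existsP; exists m; rewrite lowS mS leqnn.
  rewrite lowS (negPf iNS) /=; apply/andP=> -[_ /existsP[s]].
  by rewrite lowS => /andP[/andP[sS _]]; rewrite ltnNge domS.
move=> S; rewrite inE => /and3P[/subsetP sSR /set0Pn[i0 i0S] /constant_onP constS].
have cloS i : (i \in closure S) = (i \in S) || (i \in R) && (r i0 < r i).
  rewrite inE; case: (boolP (i \in S)) => [/sSR -> //|_] /=; congr (_ && _).
  apply/existsP/idP => [[s /andP[sS]]|lt_i]; last by exists i0; rewrite i0S.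
  by rewrite (constS s i0).
have min_i0 i : i \in closure S -> r i0 <= r i.
  by rewrite cloS => /orP[iS|/andP[_ /ltnW //]]; rewrite (constS i0 i).
split.
  rewrite inE; apply/and3P; split.
  - by apply/subsetP=> i; rewrite inE => /andP[].
  - by apply/set0Pn; exists i0; rewrite cloS i0S.
  - apply/dominatesP=> i i' /min_i0 le_i; rewrite cloS => /norP[_].
    rewrite negb_and -leqNgt => /orP[/r0 -> //|le_i']; exact: leq_trans le_i.
apply/setP=> i; rewrite inE; apply/andP/idP => [[]|iS].
  rewrite cloS => /orP[//|/andP[_ lt_i] /forall_inP/(_ i0)].
  by rewrite cloS i0S /= leqNgt lt_i => /(_ isT).
split; first by rewrite cloS iS.
by apply/forall_inP=> s /min_i0; rewrite (constS i i0).
Qed.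

(** Equal rows carry the information of one of them: keep row t and erase the
    other rows of T, or conversely copy row t on all of T. *)
Lemma card_constant_on (n k : nat) (z : bool) (R T : {set 'I_n}) (t : 'I_n) :
    T \subset R -> t \in T ->
  #|[set M : 'M[bool]_(n, k) | [&& nested M, z || every_col_has_1 M & rows_in R M]
        && constant_on (fun i => #|row_set M i|) T]|
    = count_in (@nested n) z k (R :\: (T :\ t)).
Proof.
move=> /subsetP sTR tT.
pose erase (M : 'M[bool]_(n, k)) : 'M[bool]_(n, k) :=
  (\matrix_(i, j) ((i \notin T :\ t) && M i j))%R.
pose copy (M : 'M[bool]_(n, k)) : 'M[bool]_(n, k) :=
  (\matrix_(i, j) M (if i \in T then t else i) j)%R.
apply: (@card_in_cancel _ _ _ _ erase copy) => M; rewrite !inE.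
  case/andP=> /and3P[nestM colM /rows_inP inR] /constant_onP constM.
  have rowT i j : i \in T -> M i j = M t j.
    move=> iT; have eq_r := constM i t iT tT.
    have /eqP/setP/(_ j) : row_set M i == row_set M t.
      by rewrite eqEsubset !nested_row_subset ?eq_r.
    by rewrite !inE.
  split.
    apply/and3P; split.
    - apply/nestedP=> i i' j j'; rewrite !mxE => /andP[-> Mij] /andP[-> Mij'].
      by move/nestedP: nestM; apply.
    - case: z colM => //= /every_colP colM; apply/every_colP=> j.
      have [i Mij] := colM j; have [iT|iNT] := boolP (i \in T :\ t).
        by exists t; rewrite mxE !inE eqxx -(rowT i) //; case/setD1P: iT.
      by exists i; rewrite mxE iNT.
    - apply/rows_inP=> i j; rewrite mxE => /andP[iNT Mij].
      by rewrite inE iNT (inR _ _ Mij).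
  apply/matrixP=> i j; rewrite !mxE; case: (boolP (i \in T)) => [iT|iNT].
    by rewrite !inE eqxx /= (rowT i).
  by rewrite !inE (negPf iNT) andbF.
case/and3P=> nestM colM /rows_inP inR.
have copyE i j : M i j -> copy M i j.
  move=> Mij; have:= inR _ _ Mij; rewrite !inE mxE => /andP[].
  by case: (boolP (i \in T)) => //= iT; rewrite andbT negbK => /eqP <-.
split.
  apply/andP; split; [apply/and3P; split|].
  - by apply/nestedP=> i i' j j'; rewrite !mxE; move/nestedP: nestM; apply.
  - case: z colM => //= /every_colP colM; apply/every_colP=> j.
    by have [i Mij] := colM j; exists i; exact: copyE.
  - apply/rows_inP=> i j; rewrite mxE; case: (boolP (i \in T)) => [/sTR //|_ /inR].
    by rewrite inE => /andP[].
  - apply/constant_onP=> i i' iT i'T; apply: eq_card => j.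
    by rewrite !inE !mxE iT i'T.
apply/matrixP=> i j; rewrite !mxE; case: (boolP (i \in T :\ t)) => [iT|] /=.
  by apply/esym/negP=> /inR; rewrite inE iT.
by rewrite !inE negb_and negbK => /orP[/eqP ->|/negPf -> //]; rewrite tT.
Qed.

Lemma card_set_sum (T : finType) (P : pred T) : #|[set x | P x]| = \sum_x P x.
Proof.
by rewrite -sum1_card big_mkcond /=; apply: eq_bigr => x _; rewrite inE; case: (P x).
Qed.

(** Double counting of pairs: for a fixed M, the admissible last columns S are as
    numerous as the nonempty sets T of equal rows ([card_dominates]); for a fixed
    T, the matrices M are counted by [card_constant_on]. *)
Lemma count_nested (n : nat) (z : bool) (k : nat) (R : {set 'I_n}) :
  count_in (@nested n) z k R = colwise_count z k #|R|.
Proof.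
elim: k R => [|k IHk] R; first by apply: count_in0 => A; apply/nestedP=> ? ? [].
rewrite count_inS /= => [|M]; last first.
  rewrite nested_add_col -[RHS]andbT; congr andb.
  by apply/dominatesP=> i i'; rewrite inE.
rewrite IHk -(sum_nonempty_subsets _ (fun m => colwise_count z k (#|R| - m))).
congr (_ + _).
pose good (M : 'M[bool]_(n, k)) := [&& nested M, z || every_col_has_1 M & rows_in R M].
transitivity (\sum_(M | good M) #|[set S : {set 'I_n} |
    [&& S \subset R, S != set0 & dominates (fun i => #|row_set M i|) S]]|).
  under eq_bigr => S _ do rewrite card_set_sum.
  rewrite exchange_big [RHS]big_mkcond /=; apply: eq_bigr => M _.
  rewrite card_set_sum big_mkcond /= /good.
  rewrite -[RHS]mulnbl big_distrr /=; apply: eq_bigr => S _.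
  rewrite nested_add_col; case: (S \subset R); case: (S != set0) => /=; rewrite ?muln0 //.
  by rewrite mulnb -!andbA; congr nat_of_bool; case: (nested M) => //=; rewrite andbC !andbA.
transitivity (\sum_(M | good M) #|[set S : {set 'I_n} |
    [&& S \subset R, S != set0 & constant_on (fun i => #|row_set M i|) S]]|).
  apply: eq_bigr => M /and3P[_ _ /rows_inP inR]; apply: card_dominates => i iNR.
  apply/eqP; rewrite cards_eq0; apply/eqP/setP=> j; rewrite !inE.
  by apply/negP=> /inR; rewrite (negPf iNR).
transitivity (\sum_(T : {set 'I_n} | (T \subset R) && (T != set0))
    #|[set M | good M && constant_on (fun i => #|row_set M i|) T]|).
  under [RHS]eq_bigr => S _ do rewrite card_set_sum.
  rewrite exchange_big [LHS]big_mkcond /=; apply: eq_bigr => M _.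
  rewrite card_set_sum [RHS]big_mkcond /=.
  rewrite -mulnbl big_distrr /=; apply: eq_bigr => S _.
  by case: (S \subset R); case: (S != set0); rewrite /= ?muln0 // mulnb.
apply: eq_bigr => T /andP[sTR /set0Pn[t tT]].
rewrite (@card_constant_on n k z R T t) // IHk cardsD (setIidPr _) ?(cardsD1 t T) ?tT //.
exact: subset_trans (subsetDl _ _) sTR.
Qed.

(** * Prescribing the set of nonzero rows *)
Definition row_supp (n k : nat) (A : 'M[bool]_(n, k)) : {set 'I_n} :=
  [set i | [exists j, A i j]].

Lemma rows_in_supp (n k : nat) (R : {set 'I_n}) (A : 'M[bool]_(n, k)) :
  rows_in R A = (row_supp A \subset R).
Proof.
apply/rows_inP/subsetP => [h i | h i j Aij].
  by rewrite inE => /existsP[j]; exact: h.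
by apply: h; rewrite inE; apply/existsP; exists j.
Qed.

Lemma every_row_supp (n k : nat) (A : 'M[bool]_(n, k)) :
  every_row_has_1 A = (row_supp A == setT).
Proof.
apply/forallP/eqP => [h | /setP h i]; last by have := h i; rewrite !inE.
by apply/setP=> i; rewrite !inE h.
Qed.

Definition count_on (n k : nat) (P : pred 'M[bool]_(n, k)) (R : {set 'I_n}) : nat :=
  #|[set A | P A & row_supp A == R]|.

Lemma card_rows_in_split (n k : nat) (P : pred 'M[bool]_(n, k)) (R : {set 'I_n}) :
  #|[set A | P A & rows_in R A]|
    = count_on P R + \sum_(R' : {set 'I_n} | R' \proper R) count_on P R'.
Proof.
rewrite -sum1_card (partition_big (@row_supp n k) (fun R' => R' \subset R)) /=; last first.
  by move=> A; rewrite inE rows_in_supp => /andP[].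
have blockE (R' : {set 'I_n}) : R' \subset R ->
    \sum_(A | (A \in [set A | P A & rows_in R A]) && (row_supp A == R')) 1 = count_on P R'.
  move=> sR'R; rewrite sum1_card /count_on cardsE; apply: eq_card => A.
  rewrite unfold_in inE rows_in_supp [in RHS]unfold_in.
  by case: eqP => [->|]; rewrite ?sR'R ?andbT ?andbF.
rewrite (bigD1 R) //= blockE //; congr (_ + _).
apply: eq_big => [R'|R' /andP[sR'R _]]; last exact: blockE.
by rewrite properEneq andbC.
Qed.

(** Inversion over subsets: the sums over all subsets of R determine the terms,
    by induction on the cardinal of R. *)
Lemma eq_count_on (n k : nat) (P Q : pred 'M[bool]_(n, k)) :
    (forall R, #|[set A | P A & rows_in R A]| = #|[set A | Q A & rows_in R A]|) ->
  forall R, count_on P R = count_on Q R.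
Proof.
move=> eqPQ R; have [m] := ubnP #|R|; elim: m R => // m IHm R le_Rm.
have := eqPQ R; rewrite !card_rows_in_split.
rewrite (eq_bigr (count_on Q)); first exact: addIn.
by move=> R' /proper_card lt_R'; apply: IHm; exact: leq_trans lt_R' _.
Qed.

(** * Ryser's characterization of lonesum matrices *)

(** Exchanging the two columns inside the two rows of the switch amounts to
    exchanging the two rows inside the two columns; the first description shows
    that row sums are kept, the second that column sums are. *)
Lemma switch_preserves_sums (n k : nat) (A : 'M[bool]_(n, k)) (i i' : 'I_n) (j j' : 'I_k) :
    A i j -> A i' j' -> ~~ A i j' -> ~~ A i' j ->
  let A' := (\matrix_(x, y) if (x == i) || (x == i') then A x (tperm j j' y) else A x y)%R in
  row_sums A' = row_sums A /\ col_sums A' = col_sums A.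
Proof.
move=> Aij Aij' nAij nAij' A'; split.
  apply/colP=> x; rewrite !mxE; case: (boolP ((x == i) || (x == i'))) => xI.
    rewrite [RHS](reindex_inj (@perm_inj _ (tperm j j'))) /=.
    by apply: eq_bigr => y _; rewrite mxE xI.
  by apply: eq_bigr => y _; rewrite mxE (negPf xI).
have A'E x y : A' x y = if (y == j) || (y == j') then A (tperm i i' x) y else A x y.
  rewrite mxE; case: (tpermP i i' x) => [->|->|/eqP xi /eqP xi'].
  - rewrite eqxx /=; case: tpermP => [->|->|/eqP/negPf -> /eqP/negPf -> //];
      by rewrite eqxx ?orbT ?Aij ?(negPf nAij) ?Aij' ?(negPf nAij').
  - rewrite eqxx orbT; case: tpermP => [->|->|/eqP/negPf -> /eqP/negPf -> //];
      by rewrite eqxx ?orbT ?Aij ?(negPf nAij) ?Aij' ?(negPf nAij').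
  - by rewrite (negPf xi) (negPf xi') /=; case: ifP.
apply/rowP=> y; rewrite !mxE; case: (boolP ((y == j) || (y == j'))) => yJ.
  rewrite [RHS](reindex_inj (@perm_inj _ (tperm i i'))) /=.
  by apply: eq_bigr => x _; rewrite A'E yJ.
by apply: eq_bigr => x _; rewrite A'E (negPf yJ).
Qed.

Lemma lonesum_nested (n k : nat) (A : 'M[bool]_(n, k)) : lonesum A -> nested A.
Proof.
move=> /forallP loneA; apply/nestedP=> i i' j j' Aij Aij'; apply/norP=> -[nAij nAij'].
have [eq_row eq_col] := switch_preserves_sums Aij Aij' nAij nAij'.
have /implyP := loneA (\matrix_(x, y)
  if (x == i) || (x == i') then A x (tperm j j' y) else A x y)%R.
rewrite eq_row eq_col !eqxx => /(_ isT)/eqP/matrixP/(_ i j).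
by rewrite mxE eqxx tpermL Aij (negPf nAij).
Qed.

(** In a chain, the rows with a 1 in column j are the largest ones, so they are
    found by comparing the row sum with a threshold that depends on j only. *)
Lemma nested_threshold (n k : nat) (A : 'M[bool]_(n, k)) (i : 'I_n) (j : 'I_k) :
  nested A -> A i j = (\max_(i' | ~~ A i' j) #|row_set A i'| < #|row_set A i|).
Proof.
move=> nestA; case: (boolP (A i j)) => [Aij|nAij]; apply/esym.
  have Ai_gt0 : 0 < #|row_set A i| by apply/card_gt0P; exists j; rewrite inE.
  rewrite -(prednK Ai_gt0) ltnS; apply/bigmax_leqP=> i' nAij'.
  rewrite -ltnS prednK // ltnNge; apply: contra nAij' => le_r.
  by have /subsetP/(_ j) := nested_row_subset nestA le_r; rewrite !inE; apply.
apply/negbTE; rewrite -leqNgt.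
by rewrite (bigD1 i) //= leq_maxl.
Qed.

(** The 1s of A occupy exactly the cells where w(i, j) = 2 r_i - 2 m_j - 1 is
    positive, with r_i the row sums and m_j the thresholds, and w never vanishes.
    As w is the sum of a function of i and a function of j, the sum of
    (A - A') w vanishes as soon as A and A' have the same margins; its terms are
    nonnegative, so they all vanish and A' = A. *)
Lemma nested_lonesum (n k : nat) (A : 'M[bool]_(n, k)) : nested A -> lonesum A.
Proof.
move=> nestA; apply/forallP=> A'; apply/implyP=> /andP[/eqP/colP eq_row /eqP/rowP eq_col].
pose r i := #|row_set A i|; pose m j := \max_(i | ~~ A i j) r i.
pose d i j : int := ((A i j)%:R - (A' i j)%:R)%R.
pose w i j : int := ((r i)%:R *+ 2 - ((m j)%:R *+ 2 + 1))%R.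
have d_row i : (\sum_j d i j = 0)%R.
  by have := eq_row i; rewrite !mxE sumrB -!natr_sum => ->; rewrite subrr.
have d_col j : (\sum_i d i j = 0)%R.
  by have := eq_col j; rewrite !mxE sumrB -!natr_sum => ->; rewrite subrr.
have sum0 : (\sum_i \sum_j d i j * w i j = 0)%R.
  under eq_bigr => i _ do
    (under eq_bigr => j _ do rewrite /w mulrBr; rewrite sumrB -mulr_suml d_row mul0r).
  rewrite sumrB big1 // exchange_big big1 ?subr0 // => j _.
  by rewrite -mulr_suml d_col mul0r.
have term_ge0 i j : (0 <= d i j * w i j)%R /\ (d i j * w i j = 0 -> A' i j = A i j)%R.
  rewrite /d /w (nested_threshold i j nestA) -/(r i) -/(m j).
  by case: (ltnP (m j) (r i)) => lt_mr; case: (A' i j); split; lia.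
have row_ge0 i : (0 <= \sum_j d i j * w i j)%R.
  by apply: Num.Theory.sumr_ge0 => j _; case: (term_ge0 i j).
apply/eqP/matrixP=> i j; apply: (term_ge0 i j).2.
have /(_ i isT) := Num.Theory.psumr_eq0P (fun i _ => row_ge0 i) sum0.
by move/Num.Theory.psumr_eq0P => -> // l _; case: (term_ge0 i l).
Qed.

Lemma lonesumE (n k : nat) : @lonesum n k =1 @nested n k.
Proof. by move=> A; apply/idP/idP; [exact: lonesum_nested | exact: nested_lonesum]. Qed.

(** * The forbidden patterns *)
Lemma is_submatrix2P (n k : nat) (a b c d : bool) (A : 'M[bool]_(n, k)) :
  reflect (exists i i' : 'I_n, exists j j' : 'I_k, [/\ i < i', j < j' &
             [/\ A i j = a, A i j' = b, A i' j = c & A i' j' = d]])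
          (is_submatrix (mx2 a b c d) A).
Proof.
pose o0 : 'I_2 := ord0; pose o1 : 'I_2 := lift ord0 ord0.
apply: (iffP idP) => [/existsP[f /existsP[g /and3P[incf incg /eqP/matrixP sub]]] |].
  have lt_of p (h : {ffun 'I_2 -> 'I_p}) : increasing h -> h o0 < h o1.
    by move=> /forallP/(_ o0)/forallP/(_ o1).
  exists (f o0), (f o1), (g o0), (g o1); split; [exact: lt_of | exact: lt_of |].
  by split; [have := sub o0 o0 | have := sub o0 o1 | have := sub o1 o0 | have := sub o1 o1];
    rewrite !mxE.
case=> i [i' [j [j' [lt_i lt_j [Aa Ab Ac Ad]]]]].
pose pair p (x y : 'I_p) := [ffun u : 'I_2 => if u == 0 :> nat then x else y].
have inc_pair p (x y : 'I_p) : x < y -> increasing (pair p x y).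
  move=> lt_xy; apply/forallP=> u; apply/forallP=> v; rewrite !ffunE.
  by case: u v => [[|[|?]] ?] [[|[|?]] ?] //=.
apply/existsP; exists (pair n i i'); apply/existsP; exists (pair k j j').
rewrite !inc_pair //=; apply/eqP/matrixP=> u v; rewrite !mxE !ffunE.
by case: ifP; case: ifP.
Qed.

(** The two patterns share all entries but the upper left one, so that entry is
    unconstrained. *)
Lemma avoidsE (n k : nat) (A : 'M[bool]_(n, k)) :
  avoids [set mx2 false true true false; mx2 true true true false] A
    = le_property A.
Proof.
apply/forall_inP/le_propertyP => [avA i i' j j' lt_i lt_j A1 A2 | leA Q].
  apply/negPn/negP => /negPf A3.
  have: mx2 (A i j) true true false
      \in [set mx2 false true true false; mx2 true true true false].
    by case: (A i j); rewrite !inE eqxx ?orbT.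
  by move/avA/is_submatrix2P; apply; exists i, i', j, j'; split.
rewrite !inE => /orP[] /eqP ->; apply/is_submatrix2P => -[i [i' [j [j' [lt_i lt_j [_ A1 A2 A3]]]]]].
  by rewrite (leA i i' j j') in A3.
by rewrite (leA i i' j j') in A3.
Qed.

(** * Backward differences and poly-Bernoulli numbers *)

Local Open Scope ring_scope.
Definition nabla (f : rat -> rat) : rat -> rat := fun x => f x - f (x - 1).

Lemma eq_nabla (i : nat) (f g : rat -> rat) :
  f =1 g -> iter i nabla f =1 iter i nabla g.
Proof. by move=> fg; elim: i => //= i IHi x; rewrite /nabla !IHi. Qed.

Lemma nabla_sum (i : nat) (I : finType) (c : I -> rat) (f : I -> rat -> rat) (x : rat) :
  iter i nabla (fun y => \sum_m c m * f m y) x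
    = \sum_m c m * iter i nabla (f m) x.
Proof.
elim: i x => //= i IHi x; rewrite {1}/nabla !IHi -sumrB.
by apply: eq_bigr => m _; rewrite -mulrBr.
Qed.

Lemma nabla_shift (i : nat) (f : rat -> rat) (c x : rat) :
  iter i nabla (fun y => f (y + c)) x = iter i nabla f (x + c).
Proof. by elim: i x => //= i IHi x; rewrite /nabla !IHi addrAC. Qed.

(** Leibniz rule for the product by the identity function. *)
Lemma nabla_mulX (i : nat) (f : rat -> rat) (x : rat) :
  iter i nabla (fun y => y * f y) x
    = x * iter i nabla f x + i%:R * iter i.-1 nabla f (x - 1).
Proof.
elim: i x => [|i IHi] x; first by rewrite mul0r addr0.
rewrite iterS {1}/nabla !IHi /=.
case: i {IHi} => [|i] /=; rewrite /nabla; ring.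
Qed.

Lemma nabla_expr_eq0 (n i : nat) (x : rat) :
  (n < i)%N -> iter i nabla (fun y => y ^+ n) x = 0.
Proof.
elim: n i x => [|n IHn] [|i] // x lt_ni.
  elim: i x {lt_ni} => [|i IHi] x; first by rewrite /= /nabla !expr0 subrr.
  by rewrite iterS /nabla !IHi subrr.
rewrite (@eq_nabla i.+1 _ (fun y => y * y ^+ n)); last by move=> y; rewrite exprS.
by rewrite nabla_mulX !IHn ?mulr0 ?addr0 // ltnW.
Qed.

Definition nabla_pow0 (n i : nat) : rat := iter i nabla (fun y => y ^+ n) 0.

(** In exponential generating functions in x of the powers y ^ n, that is in
    e^{xy}, multiplying by e^{-x} shifts y by -1; hence multiplying by
    1 - e^{-x} is the backward difference in y. *)
Lemma fps_exp_one_sub_expN (i n : nat) :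
  (n`!)%:R * fps_exp one_sub_expN i n = nabla_pow0 n i.
Proof.
elim: i n => [|i IHi] n.
  rewrite /nabla_pow0 /fps_exp /= expr0n.
  by case: n => [|n]; rewrite ?mulr0 // fact0 mulr1.
rewrite /fps_exp iterS -/(fps_exp one_sub_expN i) /fps_mul mulr_sumr.
have term (l : 'I_n.+1) : (n`!)%:R * (one_sub_expN l * fps_exp one_sub_expN i (n - l)%N)
   = (val l == 0%N)%:R * nabla_pow0 n i
     - ('C(n, l)%:R * (-1) ^+ l) * nabla_pow0 (n - l) i.
  have le_ln : (l <= n)%N by rewrite -ltnS.
  have fact_neq0 m : (m`!)%:R != 0 :> rat by rewrite Num.Theory.pnatr_eq0 -lt0n fact_gt0.
  rewrite /one_sub_expN mulrBl mulrBr; congr (_ - _).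
    by case: eqP => [->|_]; rewrite ?mul0r ?mulr0 // subn0 !mul1r IHi.
  rewrite -IHi -(bin_fact le_ln) !natrM; field; exact: fact_neq0.
rewrite (eq_bigr _ (fun l _ => term l)) sumrB -mulr_suml.
rewrite big_ord_recl /= big1 // addr0 mul1r.
rewrite [nabla_pow0 n i.+1]/nabla_pow0 iterS {1}/nabla; congr (_ - _).
rewrite sub0r -[- 1]add0r -nabla_shift -nabla_sum add0r.
apply: eq_nabla => y; rewrite exprDn.
by apply: eq_bigr => l _; rewrite -mulr_natl; ring.
Qed.

Lemma poly_bernoulliE (n k : nat) :
  poly_bernoulli n k = \sum_(i < n.+1) ((i.+1 ^ k)%N)%:R * nabla_pow0 n i.
Proof.
rewrite /poly_bernoulli /poly_bernoulli_gf /fps_comp mulr_sumr.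
by apply: eq_bigr => i _; rewrite -fps_exp_one_sub_expN mulrCA.
Qed.

(** The values at 0 of the successive differences telescope to the value of y ^ n
    at 1, because the difference of order n + 1 vanishes. *)
Lemma poly_bernoulli0 (n : nat) : poly_bernoulli n 0 = 1.
Proof.
rewrite poly_bernoulliE.
have telescope m : \sum_(i < m) nabla_pow0 n i
    = 1 - iter m nabla (fun y => y ^+ n) 1.
  elim: m => [|m IHm]; first by rewrite big_ord0 /= expr1n subrr.
  by rewrite big_ord_recr IHm iterS /= {2}/nabla subrr /nabla_pow0; ring.
under eq_bigr => i _ do rewrite expn0 mul1r.
by rewrite telescope nabla_expr_eq0 // subr0.
Qed.

(** The right-hand side is the i-th difference at 0 of y ((y + 1) ^ n - y ^ n).
    By the Leibniz rule at 0 it reduces to i times the difference of order i - 1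
    of (y + 1) ^ n - y ^ n at -1, which is the i-th difference of y ^ n at 0. *)
Lemma mul_nabla_pow0 (n i : nat) :
  i%:R * nabla_pow0 n i = \sum_(m < n) 'C(n, m.+1)%:R * nabla_pow0 (n - m) i.
Proof.
rewrite /nabla_pow0 -nabla_sum.
rewrite [RHS](@eq_nabla i _ (fun y => y * ((y + 1) ^+ n - y ^+ n))).
  rewrite nabla_mulX mul0r add0r; case: i => [|i]; first by rewrite !mul0r.
  congr (_ * _); pose f (y : rat) := y ^+ n.
  rewrite iterSr [RHS](@eq_nabla i _ (fun y => nabla f (y + 1))) ?nabla_shift ?subrK //.
  by move=> y; rewrite /nabla /f addrK.
move=> y; rewrite exprDn big_ord_recl subn0 bin0 expr0 mulr1 mulr1n.
rewrite addrC addKr mulr_sumr; apply: eq_bigr => m _.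
rewrite expr1n mulr1 /= /bump /= add1n mulrnAr -exprS mulr_natl.
by rewrite -subSn ?subSS.
Qed.

(** Writing (i + 1) ^ (k + 1) as (i + 1) ^ k + (i + 1) ^ k i, the second term is
    expanded by [mul_nabla_pow0]. *)
Lemma poly_bernoulliS (n k : nat) :
  poly_bernoulli n k.+1 = poly_bernoulli n k
    + \sum_(m < n) 'C(n, m.+1)%:R * poly_bernoulli (n - m) k.
Proof.
(* The extra terms i > n - m vanish, so all the sums may run to n. *)
have widen (m : 'I_n) : poly_bernoulli (n - m) k
    = \sum_(i < n.+1) ((i.+1 ^ k)%N)%:R * nabla_pow0 (n - m) i.
  rewrite poly_bernoulliE (big_ord_widen n.+1
    (fun i => ((i.+1 ^ k)%N)%:R * nabla_pow0 (n - m) i)) ?ltnS ?leq_subr //.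
  rewrite big_mkcond /=; apply: eq_bigr => i _.
  by case: ltnP => // lt_i; rewrite /nabla_pow0 nabla_expr_eq0 // mulr0.
rewrite (eq_bigr _ (fun m _ => congr1 _ (widen m))) !poly_bernoulliE.
under [X in _ = _ + X]eq_bigr => m _ do rewrite mulr_sumr.
rewrite exchange_big -big_split; apply: eq_bigr => i _ /=.
under [X in _ = _ + X]eq_bigr => m _ do rewrite mulrCA.
rewrite -mulr_sumr -mul_nabla_pow0 expnS natrM -[i.+1]addn1 natrD; ring.
Qed.

Lemma colwise_count_poly_bernoulli (n k : nat) :
  (colwise_count true k n)%:R = poly_bernoulli n k.
Proof.
elim: k n => [|k IHk] n; first by rewrite poly_bernoulli0.
rewrite poly_bernoulliS /= mul1n natrD IHk natr_sum; congr (_ + _).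
by apply: eq_bigr => m _; rewrite natrM IHk.
Qed.

(** * The three equalities *)

Lemma rows_inT (n k : nat) (A : 'M[bool]_(n, k)) : rows_in setT A.
Proof. by apply/rows_inP=> i j _; rewrite inE. Qed.

Theorem theorem6 (n k : nat) (hn : (0 < n)%N) (hk : (0 < k)%N) :
  let P : {set 'M[bool]_2} :=
    [set mx2 false true true false; mx2 true true true false] in
  [/\ #|[set A : 'M[bool]_(n, k) | avoids P A]|%:R = poly_bernoulli n k,
      #|[set A : 'M[bool]_(n, k) | avoids P A & every_col_has_1 A]|
        = lonesum_C n k
    & #|[set A : 'M[bool]_(n, k) |
          [&& avoids P A, every_row_has_1 A & every_col_has_1 A]]|
        = lonesum_D n k].
Proof.
move=> P; split.
- rewrite -colwise_count_poly_bernoulli -[in RHS](card_ord n) -cardsT.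
  rewrite -count_le_property; congr (_%:R); apply: eq_card => A.
  by rewrite !inE avoidsE rows_inT /= andbT.
- transitivity (count_in (@le_property n) false k setT).
    by apply: eq_card => A; rewrite !inE avoidsE rows_inT /= andbT.
  rewrite count_le_property -count_nested; apply: eq_card => A.
  by rewrite !inE lonesumE rows_inT /= andbT.
- transitivity (count_on [pred A : 'M[bool]_(n, k) | le_property A && every_col_has_1 A] setT).
    by apply: eq_card => A; rewrite !inE avoidsE every_row_supp /= -andbA [_ && (_ == _)]andbC.
  rewrite (@eq_count_on _ _ _ [pred A | nested A && every_col_has_1 A]) => [|R].
    by apply: eq_card => A; rewrite !inE lonesumE every_row_supp /= andbA.
  transitivity (count_in (@le_property n) false k R).
    by apply: eq_card => A; rewrite !inE /= andbA.
  rewrite count_le_property -count_nested.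
  by apply: eq_card => A; rewrite !inE /= andbA.
Qed.
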